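(* Let $T$ be a noncrossing tree on the vertex set $[n]$, and let $R_T(x_{ij}\mid 1\le i<j\le n)$ be an arbitrary reduced form of the monomial $m[T]$. Let $R_T(t_1,\ldots,t_{n-1})$ be the polynomial obtained from $R_T(x_{ij}\mid 1\le i<j\le n)$ by setting $x_{ij}=t_i$ for all $1\le i<j\le n$. Then $$R_T(t_1,\ldots,t_{n-1})=\mathrm{Crf}_T(t_1,\ldots,t_{n-1}).$$
   Context: A graph on $[n]$ is noncrossing if there are no $i<j<k<l$ such that $(i,k)$ and $(j,l)$ are both edges. The subdivision algebra $\mathcal{S}(\beta)$ is the commutative algebra over $\mathbb{Q}[\beta]$ generated by $x_{ij}$, $1\le i<j\le n$, subject to the relations $x_{ij}x_{jk}=x_{ik}(x_{ij}+x_{jk}+\beta)$ for $1\le i<j<k\le n$. A reduced form of a monomial is a polynomial obtained by successively substituting $x_{ik}(x_{ij}+x_{jk}+\beta)$ in place of an occurrence of $x_{ij}x_{jk}$ ($i<j<k$), the reductions being performed on each monomial separately, until no further reduction is possible. Reduced forms need not be unique. For a noncrossing tree $T$ on $[n]$, $m[T]=\prod_{(i,j)\in E(T),\,i<j}x_{ij}$. The canonical reduced form $\mathrm{Crf}_T(x_{ij}\mid 1\le i<j\le n)$ of $m[T]$ is the reduced form obtained by performing the reductions from front to back (or back to front) along the vertices $1,2,\ldots,n$, always on the topmost edges: at a vertex $j$ at which there are both an edge $(i,j)$ with $i<j$ and an edge $(j,k)$ with $j<k$, the reduction is performed on the pair with $i$ smallest and $k$ largest. $\mathrm{Crf}_T(t_1,\ldots,t_{n-1})$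 denotes $\mathrm{Crf}_T$ with $x_{ij}=t_i$ for all $i<j$. *)

(* Defs.v *)
From Stdlib Require Import Relation_Operators.
From mathcomp Require Import all_boot all_order all_algebra.
From mathcomp Require Import mpoly zify.

Set Implicit Arguments.
Unset Strict Implicit.
Unset Printing Implicit Defensive.

Import GRing.Theory.
Local Open Scope ring_scope.

(* The vertex set [n] = {1, ..., n} is 'I_n = {0, ..., n - 1}; an edge is a
   pair (i, j) with i < j, and a simple graph on [n] is a {set edge n}. *)
Definition edge (n : nat) := {e : 'I_n * 'I_n | (e.1 < e.2)%N}.

Definition src n (e : edge n) : 'I_n := (val e).1.
Definition tgt n (e : edge n) : 'I_n := (val e).2.

Definition adj n (T : {set edge n}) : rel 'I_n :=
  fun u v => [exists e in T, (val e == (u, v)) || (val e == (v, u))].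

Definition noncrossing n (T : {set edge n}) : Prop :=
  forall e f : edge n, e \in T -> f \in T ->
    ~ [/\ (src e < src f)%N, (src f < tgt e)%N & (tgt e < tgt f)%N].

(* A cycle is a cyclic sequence of at least 3 pairwise distinct vertices;
   ucycle also accepts the sequence [:: u; v] when u and v are adjacent. *)
Definition is_tree n (T : {set edge n}) : Prop :=
  [/\ (0 < n)%N,
      forall u v : 'I_n, connect (adj T) u v
    & forall c : seq 'I_n, ucycle (adj T) c -> (size c <= 2)%N].

(* Q[beta] is {poly rat}, with beta = 'X. The variables x_ij are indexed by
   the edges, through the enumeration of the finite type edge n. *)
Notation xmonom n := 'X_{1..#|{: edge n}|}.
Notation xpoly n := {mpoly {poly rat}[#|{: edge n}|]}.

Definition x n (e : edge n) : xmonom n := U_(enum_rank e)%MM.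

Definition tree_monom n (T : {set edge n}) : xmonom n :=
  (\big[mnm_add/mnm0]_(e in T) x e)%MM.

(* The triple of edges r = (e, f, g) has the form ((i, j), (j, k), (i, k)),
   and x_ij x_jk divides m (x_ij and x_jk are distinct variables). *)
Definition redex n (m : xmonom n) (r : edge n * edge n * edge n) : bool :=
  let: (e, f, g) := r in
  [&& tgt e == src f, src g == src e, tgt g == tgt f,
      (0 < m (enum_rank e))%N & (0 < m (enum_rank f))%N].

(* With m = m' x_ij x_jk, these are the three terms of
   m' x_ik (x_ij + x_jk + beta), as pairs (coefficient, monomial). *)
Definition reducts n (m : xmonom n) (r : edge n * edge n * edge n) :
    seq ({poly rat} * xmonom n) :=
  let: (e, f, g) := r in
  let m' := (m - x e - x f)%MM in
  [:: (1, (m' + x g + x e)%MM);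
      (1, (m' + x g + x f)%MM);
      ('X, (m' + x g)%MM)].

Definition irreducible n (m : xmonom n) : bool := [forall r, ~~ redex m r].

(* Reductions act on one term at a time of a formal sum of terms. Like terms
   are not collected, so they may be reduced further in different ways. *)
Inductive reduction n :
    seq ({poly rat} * xmonom n) -> seq ({poly rat} * xmonom n) -> Prop :=
| Reduction s1 c m s2 r : redex m r ->
    reduction (s1 ++ (c, m) :: s2)
              (s1 ++ [seq (c * t.1, t.2) | t <- reducts m r] ++ s2).

Definition poly_of n (s : seq ({poly rat} * xmonom n)) : xpoly n :=
  \sum_(t <- s) t.1 *: 'X_[t.2].

Definition reduced_form n (m : xmonom n) (p : xpoly n) : Prop :=
  exists s : seq ({poly rat} * xmonom n),
    [/\ clos_refl_trans _ (@reduction n) [:: (1, m)] s,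
        all (fun t => irreducible t.2) s
      & p = poly_of s].

(* The two orders in which the vertices may be processed. *)
Inductive direction := FrontToBack | BackToFront.

Definition visited_before n (d : direction) (u v : 'I_n) : bool :=
  match d with
  | FrontToBack => (u < v)%N
  | BackToFront => (v < u)%N
  end.

(* r = ((i, j), (j, k), (i, k)) is the reduction to be performed next on m:
   j is the first vertex at which m can be reduced, and among the reductions
   of m at j, i is smallest and k is largest. *)
Definition canonical_redex n (d : direction) (m : xmonom n)
    (r : edge n * edge n * edge n) : bool :=
  redex m r &&
  [forall r' : edge n * edge n * edge n, redex m r' ==>
    (visited_before d (tgt r.1.1) (tgt r'.1.1)
     || [&& tgt r.1.1 == tgt r'.1.1, (src r.1.1 <= src r'.1.1)%N
          & (tgt r'.1.2 <= tgt r.1.2)%N])].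

(* Every reduction strictly decreases this weight, which therefore bounds the
   number of successive reductions: see Crf_reduced_form below. *)
Definition weight n (m : xmonom n) : nat :=
  (\sum_(e : edge n) m (enum_rank e) * (n - (tgt e - src e)))%N.

Fixpoint crf_rec n (d : direction) (fuel : nat) (m : xmonom n) : xpoly n :=
  if fuel is fuel'.+1 then
    if [pick r | canonical_redex d m r] is Some r then
      \sum_(t <- reducts m r) t.1 *: crf_rec d fuel' t.2
    else 'X_[m]
  else 'X_[m].

Definition Crf n (d : direction) (T : {set edge n}) : xpoly n :=
  crf_rec d (weight (tree_monom T)) (tree_monom T).

Lemma src_lt_tgt n (e : edge n) : (src e < tgt e)%N.
Proof. exact: valP e. Qed.

Lemma redex_split n (m : xmonom n) e f g : redex m (e, f, g) ->
  (m = (m - x e - x f) + x e + x f)%MM.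
Proof.
case/and5P=> /eqP tesf _ _ me mf.
have nef : e != f.
  by apply/eqP=> eef; have := src_lt_tgt e; rewrite tesf eef ltnn.
apply/mnmP=> i; rewrite !(mnmDE, mnmBE) !mnm1E.
have [ei|_] := eqVneq (enum_rank e) i; have [fi|_] := eqVneq (enum_rank f) i.
- by case/eqP: nef; apply: enum_rank_inj; rewrite ei.
- by rewrite -ei subn0 addn0 subn1 addn1 prednK.
- by rewrite -fi subn0 addn0 subn1 addn1 prednK.
by rewrite !subn0 !addn0.
Qed.

Lemma weightD n (m1 m2 : xmonom n) :
  weight (m1 + m2)%MM = (weight m1 + weight m2)%N.
Proof.
by rewrite -big_split; apply: eq_bigr => e _; rewrite mnmDE mulnDl.
Qed.

Lemma weight_x n (e : edge n) : weight (x e) = (n - (tgt e - src e))%N.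
Proof.
rewrite /weight (bigD1 e) //= mnm1E eqxx mul1n big1 ?addn0 // => f nfe.
by rewrite mnm1E (inj_eq enum_rank_inj) eq_sym (negPf nfe).
Qed.

Lemma weight_reducts n (m : xmonom n) r t :
  redex m r -> t \in reducts m r -> (weight t.2 < weight m)%N.
Proof.
case: r => [[e f] g] rm; rewrite {2}(redex_split rm) /reducts.
case/and5P: rm => /eqP te /eqP sg /eqP tg _ _.
have lt_e := src_lt_tgt e; have lt_f := src_lt_tgt f.
have lt_n := ltn_ord (tgt f); rewrite te in lt_e.
have := (weight_x e, weight_x f, weight_x g); rewrite te sg tg => wx.
by rewrite !inE => /or3P[] /eqP-> /=; rewrite !weightD !wx; lia.
Qed.

Lemma canonical_redex_exists n d (m : xmonom n) r :
  redex m r -> exists r', canonical_redex d m r'.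
Proof.
move=> rm.
pose rank (v : 'I_n) : nat := if d is BackToFront then (n - v)%N else v.
pose key (r : edge n * edge n * edge n) : nat :=
  (rank (tgt r.1.1) * (2 * n + 1) + src r.1.1 + (n - tgt r.1.2))%N.
have [[[e f] g] em emin] := arg_minnP key rm.
exists (e, f, g); rewrite /canonical_redex em; apply/forallP=> -[[e' f'] g'].
apply/implyP=> em' /=.
case/and5P: (em) => /eqP te sg tg me mf.
case/and5P: (em') => /eqP te' sg' tg' me' mf'.
have ltke : (src e < tgt e)%N := src_lt_tgt e.
have := emin _ em'; rewrite /key /= => le1.
have rank_lt u v : (rank u < rank v)%N -> visited_before d u v.
  by rewrite /rank /visited_before; have := ltn_ord u; case: (d) => *; lia.
have rank_inj u v : rank u = rank v -> u = v.
  move=> ruv; apply: val_inj => /=; move: ruv; rewrite /rank.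
  by have := ltn_ord u; have := ltn_ord v; case: (d) => *; lia.
have [/rank_lt->//|] := ltnP (rank (tgt e)) (rank (tgt e')).
rewrite leq_eqVlt => /orP[/eqP/rank_inj eqt|lt]; last first.
  exfalso; have := ltn_ord (src e'); nia.
have merge (a b : edge n) : tgt a = src b ->
    exists c : edge n, src c = src a /\ tgt c = tgt b.
  move=> tab; have lt_ab : (src a < tgt b)%N.
    by apply: ltn_trans (src_lt_tgt a) _; rewrite tab src_lt_tgt.
  by exists (Sub (src a, tgt b) lt_ab); rewrite /src /tgt SubK.
have [c1 [sc1 tc1]] := merge e' f (etrans eqt te).
have [c2 [sc2 tc2]] := merge e f' (etrans (esym eqt) te').
have r1 : redex m (e', f, c1) by rewrite /redex eqt te sc1 tc1 !eqxx me' mf.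
have r2 : redex m (e, f', c2) by rewrite /redex -eqt te' sc2 tc2 !eqxx me mf'.
have := emin _ r1; have := emin _ r2; rewrite /key /= eqt eqxx /= => le2 le3.
apply/orP; right; have := ltn_ord (tgt f); have := ltn_ord (tgt f').
by lia.
Qed.

Lemma reductions_context n s1 s2 c a b :
  clos_refl_trans _ (@reduction n) a b ->
  clos_refl_trans _ (@reduction n)
    (s1 ++ [seq (c * t.1, t.2) | t <- a] ++ s2)
    (s1 ++ [seq (c * t.1, t.2) | t <- b] ++ s2).
Proof.
elim=> [{}a {}b [u c' m v r rm] | {}a | {}a b' {}b _ IH1 _ IH2].
- apply: rt_step; rewrite !map_cat /= -!catA /= !catA -!catA.
  rewrite catA [X in reduction _ X]catA -map_comp.
  have := Reduction (s1 ++ [seq (c * t.1, t.2) | t <- u]) (c * c')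
    ([seq (c * t.1, t.2) | t <- v] ++ s2) rm.
  congr (reduction _ _); congr (_ ++ (_ ++ _)).
  by apply: eq_map => t /=; rewrite mulrA.
- exact: rt_refl.
exact: rt_trans IH1 IH2.
Qed.

Lemma crf_rec_reduced n d fuel (m : xmonom n) :
  (weight m <= fuel)%N -> reduced_form m (crf_rec d fuel m).
Proof.
have leaf (m' : xmonom n) : irreducible m' -> reduced_form m' 'X_[m'].
  move=> im; exists [:: (1, m')]; split; [exact: rt_refl | by rewrite /= im |].
  by rewrite /poly_of big_seq1 scale1r.
elim: fuel m => [|fuel IH] m le_m /=.
  apply: leaf; apply/forallP=> -[[e f] g]; apply/negP=> rm.
  have := @weight_reducts n m (e, f, g) (1, (m - x e - x f + x g + x e)%MM) rm.
  by rewrite inE eqxx => /(_ isT) /=; lia.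
case: pickP => [r | nor]; last first.
  apply: leaf; apply/forallP=> r; apply/negP=> rm.
  by have [r'] := canonical_redex_exists d rm; rewrite nor.
case/andP=> rm _.
have IHr t : t \in reducts m r -> reduced_form t.2 (crf_rec d fuel t.2).
  by move=> /(weight_reducts rm) lt_t; apply: IH; rewrite -ltnS (leq_trans lt_t).
have [s [cs is_ es]] : exists s : seq ({poly rat} * xmonom n),
  [/\ clos_refl_trans _ (@reduction n) (reducts m r) s,
      all (fun t => irreducible t.2) s
    & \sum_(t <- reducts m r) t.1 *: crf_rec d fuel t.2 = poly_of s].
  elim: (reducts m r) IHr => [|t a IHa] IHt.
    by exists [::]; rewrite /poly_of !big_nil; split=> //; exact: rt_refl.
  have [|s [cs is_ es]] := IHa; first by move=> u ua; apply: IHt; rewrite inE ua orbT.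
  have [s' [cs' is' es']] := IHt t (mem_head _ _).
  exists ([seq (t.1 * u.1, u.2) | u <- s'] ++ s); split.
  - apply: rt_trans (reductions_context [::] s t.1 cs').
    have := reductions_context [:: t] [::] 1 cs.
    have id1 (b : seq ({poly rat} * xmonom n)) : [seq (1 * u.1, u.2) | u <- b] = b.
      by rewrite -[RHS]map_id; apply: eq_map => -[? ?] /=; rewrite mul1r.
    by rewrite !id1 !cats0 /= mulr1 -surjective_pairing.
  - by rewrite all_cat all_map is_ andbT.
  rewrite big_cons es es' /poly_of big_cat big_map /=.
  by congr (_ + _); rewrite scaler_sumr; apply: eq_bigr => u _; rewrite scalerA.
exists s; split=> //; apply: rt_trans cs; apply: rt_step.
have := Reduction [::] 1 [::] rm; rewrite /= cats0; congr (reduction _ _).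
by rewrite -[RHS]map_id; apply: eq_map => -[? ?] /=; rewrite mul1r.
Qed.

Lemma Crf_reduced_form n d (T : {set edge n}) :
  reduced_form (tree_monom T) (Crf d T).
Proof. exact: crf_rec_reduced. Qed.

Lemma src_lt n (e : edge n) : (src e < n.-1)%N.
Proof.
by rewrite ltn_predRL; apply: leq_ltn_trans (src_lt_tgt e) (ltn_ord _).
Qed.

(* The substitution x_ij = t_i, into Q[beta][t_1, ..., t_(n-1)]. *)
Definition specialize n (p : xpoly n) : {mpoly {poly rat}[n.-1]} :=
  p \mPo [tuple 'X_(Ordinal (src_lt (enum_val v))) | v < #|{: edge n}|].

(* Main.v *)
(* In terms of 1 + beta / x_ij the relations say that these elements multiply
   along i < j < k, so they hold for x_ij = r_i (r_j + beta) / (r_j - r_i), where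
   1 + beta / x_ij = r_j (r_i + beta) / (r_i (r_j + beta)).  Take the polynomial
   part of such a rational function (the quotient of its numerator by its
   denominator) in the last variable r_n, then in r_(n-1), and so on, and
   substitute t_i for r_i.  In an irreducible monomial no vertex is both a source
   and a target, so a target j only contributes factors (r_j + beta) / (r_j - r_i),
   whose product has polynomial part 1, and what remains is the product of the
   t_i over the edges.  Hence the specialization of a reduced form is determined
   by the monomial that it comes from.  The argument is due to Grinberg
   (t-unique reductions for Meszaros's subdivision algebra). *)
Require Import Defs.
From Stdlib Require Import Relation_Operators.
From mathcomp Require Import all_boot all_order all_algebra.
From mathcomp Require Import fraction mpoly ring.

Set Implicit Arguments.
Unset Strict Implicit.
Unset Printing Implicit Defensive.

Import GRing.Theory.
Local Open Scope ring_scope.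
Local Open Scope quotient_scope.

(** * Polynomial parts of rational functions in one variable *)

Section PolynomialPart.
Variable F : fieldType.
Local Notation "p %:F" := (@FracField.tofrac {poly F} p).
Implicit Types (p q d : {poly F}) (u v : {fraction {poly F}}).

Definition polypart u : {poly F} := \n_(repr u) %/ \d_(repr u).

Lemma fraction_repr u : u = (\n_(repr u))%:F / (\d_(repr u))%:F.
Proof.
apply: (canRL (mulfK _)); first by rewrite tofrac_eq0 denom_ratioP.
rewrite -{1}[u]reprK !piE.
apply/eqmodP => /=; rewrite FracField.equivfE.
rewrite /FracField.mulf !numden_Ratio ?mulf_neq0 ?oner_neq0 ?denom_ratioP //.
by rewrite !mulr1 mulrC.
Qed.

(** Cross-multiplying two representations of a fraction and cancelling a common factor in the
    division shows that [polypart] does not depend on the representative. *)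
Lemma polypart_frac p d : d != 0 -> polypart (p%:F / d%:F) = p %/ d.
Proof.
move=> d0; set u := _ / _; rewrite /polypart.
have e0 := denom_ratioP (repr u).
have /eqP : u = (\n_(repr u))%:F / (\d_(repr u))%:F by exact: fraction_repr.
rewrite eqr_div ?tofrac_eq0 // -!tofracM tofrac_eq => /eqP eq_pn.
by rewrite -(divp_pmul2r p e0 d0) eq_pn [d * _]mulrC divp_pmul2r.
Qed.

Lemma polypartD u v : polypart (u + v) = polypart u + polypart v.
Proof.
rewrite (fraction_repr u) (fraction_repr v).
have d0 := denom_ratioP (repr u); have e0 := denom_ratioP (repr v).
rewrite addf_div ?tofrac_eq0 // -!tofracM -tofracD !polypart_frac ?mulf_neq0 //.
rewrite divpD divp_pmul2r //; congr (_ + _).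
by rewrite [_ * \d_(repr v)]mulrC divp_pmul2r.
Qed.

Lemma polypart_poly p : polypart p%:F = p.
Proof. by rewrite -[p%:F]divr1 -tofrac1 polypart_frac ?oner_neq0 // divp1. Qed.

Lemma polypart0 : polypart 0 = 0.
Proof. by rewrite -tofrac0 polypart_poly. Qed.

Lemma polypartZ c u : polypart (c%:P%:F * u) = c *: polypart u.
Proof.
rewrite (fraction_repr u) mulrA -tofracM.
by rewrite !polypart_frac ?denom_ratioP // mul_polyC divpZl.
Qed.

(** The leading terms cancel in [p - q], which is therefore the remainder. *)
Lemma divp_monic p q :
  p \is monic -> q \is monic -> size p = size q -> p %/ q = 1.
Proof.
move=> /monicP lp /monicP lq sz.
have q0 : q != 0 by rewrite -lead_coef_eq0 lq oner_neq0.
have -> : p = 1 * q + (p - q) by rewrite mul1r addrC subrK.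
apply: divp_addl_mul_small.
have q_gt0 : (0 < size q)%N by rewrite size_poly_gt0.
rewrite -(prednK q_gt0) ltnS; apply/leq_sizeP => i le_i.
rewrite coefB; have [lt_i | ] := ltnP i (size q); last first.
  by move=> ge_i; rewrite !nth_default ?sz // subrr.
have -> : i = (size q).-1 by apply/eqP; rewrite eqn_leq le_i -ltnS prednK ?andbT.
by rewrite -{1}sz -!lead_coefE lp lq subrr.
Qed.

End PolynomialPart.

(** * The values of the x_ij in an iterated fraction field *)

(* Rational functions over Q in beta, r_0, ..., r_(k-1), as iterated fraction
   fields, so that polynomial parts are taken from the last variable down. *)
Fixpoint tower (k : nat) : fieldType :=
  if k is k'.+1 then {fraction {poly tower k'}} else {fraction {poly rat}}.

Fixpoint base (k : nat) : {rmorphism {poly rat} -> tower k} :=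
  match k with
  | 0 => @FracField.tofrac {poly rat}
  | k'.+1 => @FracField.tofrac {poly tower k'} \o (polyC \o base k')
  end.

(* The variable r_v (junk value 0 for v >= k). *)
Fixpoint indet (k v : nat) : tower k :=
  match k with
  | 0 => 0
  | k'.+1 => FracField.tofrac (if v == k' then 'X else (indet k' v)%:P)
  end.

Definition lift k : {rmorphism tower k -> tower k.+1} :=
  (@FracField.tofrac {poly tower k}) \o polyC.

Lemma liftE k u : lift k u = FracField.tofrac u%:P. Proof. by []. Qed.

Lemma indet_lift k v : (v < k)%N -> indet k.+1 v = lift k (indet k v).
Proof. by move=> lt_vk; rewrite liftE /= ltn_eqF. Qed.

Lemma indet_neq k i j : (i < j < k)%N -> indet k j - indet k i != 0.
Proof.
elim: k => [|k IH]; first by rewrite ltn0 andbF.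
rewrite ltnS (leq_eqVlt j) => /andP[lt_ij] /orP[/eqP ejk | lt_jk]; last first.
  rewrite !indet_lift ?(ltn_trans lt_ij) // -rmorphB fmorph_eq0.
  by rewrite IH // lt_ij.
rewrite /= ejk eqxx ltn_eqF -?ejk // -tofracB tofrac_eq0.
by rewrite monic_neq0 ?monicXsubC.
Qed.

(* The value of x_ij divided by r_i. *)
Definition ratio_at k i j : tower k :=
  (indet k j + base k 'X) / (indet k j - indet k i).

Definition value_at k i j : tower k := indet k i * ratio_at k i j.

Lemma ratio_at_lift k i j :
  (i < j < k)%N -> ratio_at k.+1 i j = lift k (ratio_at k i j).
Proof.
case/andP=> lt_ij lt_jk; have lt_ik := ltn_trans lt_ij lt_jk.
by rewrite /ratio_at fmorph_div rmorphD rmorphB !indet_lift.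
Qed.

(** Stated over an abstract field so that [field] works with plain variables instead of [tower]
    terms. *)
Lemma value_relation (F : fieldType) (b r s t : F) :
  s - r != 0 -> t - s != 0 -> t - r != 0 ->
  (r * ((s + b) / (s - r))) * (s * ((t + b) / (t - s))) =
  (r * ((t + b) / (t - r))) *
    (r * ((s + b) / (s - r)) + s * ((t + b) / (t - s)) + b).
Proof. by move=> sr ts tr; field; rewrite sr ts tr. Qed.

Lemma value_at_relation k i j l : (i < j < l)%N -> (l < k)%N ->
  value_at k i j * value_at k j l =
  value_at k i l * (value_at k i j + value_at k j l + base k 'X).
Proof.
case/andP=> lt_ij lt_jl lt_lk; rewrite /value_at /ratio_at.
have ij : indet k j - indet k i != 0.
  by rewrite indet_neq // lt_ij (ltn_trans lt_jl).
have jl : indet k l - indet k j != 0 by rewrite indet_neq // lt_jl.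
have il : indet k l - indet k i != 0.
  by rewrite indet_neq // (ltn_trans lt_ij lt_jl).
exact: value_relation.
Qed.

(** * Iterated polynomial parts *)

Section Readout.
Variables (A : comNzRingType) (phi : {rmorphism {poly rat} -> A}) (t : nat -> A).

(* Taking the polynomial part in beta as well makes readout only additive, which
   is enough: scalars are carried along as polynomials in beta. *)
Fixpoint readout (k : nat) : tower k -> A :=
  match k with
  | 0 => fun u => phi (polypart u)
  | k'.+1 => fun u => (map_poly (@readout k') (polypart u)).[t k']
  end.

Lemma readout0 k : @readout k 0 = 0.
Proof.
case: k => [|k] /=; first by rewrite polypart0 rmorph0.
by rewrite polypart0 map_poly0 horner0.
Qed.

Lemma readoutD k u v : @readout k (u + v) = readout u + readout v.
Proof.
elim: k u v => [|k IH] u v /=; first by rewrite polypartD rmorphD.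
rewrite polypartD -hornerD; congr (_.[_]).
by apply/polyP=> i; rewrite coefD !coef_map_id0 ?readout0 // coefD IH.
Qed.

Lemma readout_lift k c a u : polypart u = 'X^a ->
  @readout k.+1 (lift k c * u) = readout c * t k ^+ a.
Proof.
move=> pu; rewrite /= polypartZ pu.
(* Additivity is enough here: the coefficients of ['X^a] are only 0 and 1. *)
have -> : map_poly (@readout k) (c *: 'X^a) = readout c *: 'X^a.
  apply/polyP=> i; rewrite coef_map_id0 ?readout0 // !coefZ !coefXn.
  by case: (i == a); rewrite ?mulr1n ?mulr0n ?mulr1 // !mulr0 readout0.
by rewrite hornerZ hornerXn.
Qed.

(** Sources of these edges lie below [k], so each factor is a quotient of two monic linear
    polynomials in the last variable r_k. *)
Lemma polypart_ratio_at n k (m : edge n -> nat) :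
  polypart (\prod_(e : edge n | tgt e == k :> nat)
              ratio_at k.+1 (src e) (tgt e) ^+ m e) = 1.
Proof.
pose N := \prod_(e : edge n | tgt e == k :> nat)
            ('X + (base k 'X)%:P : {poly tower k}) ^+ m e.
pose D := \prod_(e : edge n | tgt e == k :> nat)
            ('X - (indet k (src e))%:P : {poly tower k}) ^+ m e.
have -> : \prod_(e : edge n | tgt e == k :> nat)
    ratio_at k.+1 (src e) (tgt e) ^+ m e
  = FracField.tofrac N / FracField.tofrac D.
  rewrite !rmorph_prod /= -prodf_div; apply: eq_bigr => e /eqP te.
  rewrite !rmorphXn -expr_div_n; congr (_ ^+ _).
  rewrite /ratio_at /= te eqxx ltn_eqF; last by rewrite -te src_lt_tgt.
  by rewrite -tofracD -tofracB.
have [mN mD sz] : [/\ N \is monic, D \is monic & size N = size D].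
  (* This relation is stable under products, so it only has to be checked on linear factors. *)
  pose K (p q : {poly tower k}) := [/\ p \is monic, q \is monic & size p = size q].
  have K1 : K 1 1 by split; rewrite ?monic1.
  have KM p q p' q' : K p q -> K p' q' -> K (p * p') (q * q').
    case=> mp mq s [mp' mq' s']; split; rewrite ?monicMl //.
    by rewrite !size_monicM ?monic_neq0 // s s'.
  apply: (big_ind2 K) => // e _; elim: (m e) => [|i IH]; first by rewrite !expr0.
  rewrite !exprS; apply: KM => //; split.
  - by rewrite -[_%:P]opprK -polyCN monicXsubC.
  - exact: monicXsubC.
  by rewrite size_XsubC size_XaddC.
by rewrite polypart_frac ?monic_neq0 // divp_monic.
Qed.

(** Induction on the number of variables; the bounds on sources and targets select exactly the
    factors that already live in [tower k]. *)
Lemma readout_irreducible n k (m : edge n -> nat) c :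
  (forall e f : edge n, (0 < m e)%N -> (0 < m f)%N -> tgt e != src f) ->
  readout (base k c
    * (\prod_(e : edge n | (src e < k)%N) indet k (src e) ^+ m e)
    * (\prod_(e : edge n | (tgt e < k)%N) ratio_at k (src e) (tgt e) ^+ m e))
  = phi c * \prod_(e : edge n | (src e < k)%N) t (src e) ^+ m e.
Proof.
move=> irr; elim: k => [|k IH].
  by rewrite !big_pred0_eq !mulr1 /= polypart_poly.
have split_last (B : comNzRingType) (v : edge n -> 'I_n) (G : edge n -> B) :
    \prod_(e | (v e < k.+1)%N) G e =
    (\prod_(e | (v e < k)%N) G e) * \prod_(e | v e == k :> nat) G e.
  rewrite (bigID (fun e => (v e < k)%N)) /=; congr (_ * _); apply: eq_bigl => e.
    by rewrite ltnS; case: ltngtP.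
  by rewrite ltnS; case: ltngtP.
pose a := (\sum_(e : edge n | src e == k :> nat) m e)%N.
have sources (B : comNzRingType) (s : nat -> B) :
    \prod_(e : edge n | src e == k :> nat) s (src e) ^+ m e = s k ^+ a.
  by rewrite -prodrXr; apply: eq_bigr => e /eqP->.
pose last_ratios := \prod_(e : edge n | tgt e == k :> nat)
                      ratio_at k.+1 (src e) (tgt e) ^+ m e.
(* Either no edge of positive exponent starts at [k], so that [a] is 0, or by irreducibility none
   ends there, so that [last_ratios] is 1. *)
have part : polypart (FracField.tofrac 'X^a * last_ratios) = 'X^a.
  have [a0 | a_gt0] := posnP a.
    by rewrite a0 expr0 tofrac1 mul1r polypart_ratio_at.
  have [e0 /andP[/eqP se0 me0]] :
      exists e0 : edge n, (src e0 == k :> nat) && (0 < m e0)%N.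
    apply/existsP; apply: contraTT a_gt0 => /existsPn no_e; rewrite -eqn0Ngt.
    rewrite sum_nat_eq0; apply/forall_inP => e se.
    by have := no_e e; rewrite se -eqn0Ngt.
  rewrite /last_ratios big1 ?mulr1 ?polypart_poly // => e /eqP te.
  have [->|me] := posnP (m e); first by rewrite expr0.
  by have /eqP[] := irr _ _ me me0; apply: val_inj; rewrite /= te se0.
(* Apart from the factors at vertex [k], everything is lifted from [tower k] and acts as a constant
   for the last polynomial part. *)
rewrite !split_last !(sources _ (indet k.+1)) !(sources _ t) mulrA -IH.
rewrite -(readout_lift _ part); congr readout.
rewrite -/last_ratios !rmorphM !rmorph_prod /= eqxx tofracXn.
rewrite [in RHS]mulrA -!mulrA; congr (_ * _).
rewrite [X in _ * X]mulrCA; congr (_ * (_ * _)); apply: eq_bigr => e lt_ek.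
  by rewrite ltn_eqF // !rmorphXn.
by rewrite ratio_at_lift ?src_lt_tgt // liftE !rmorphXn.
Qed.

End Readout.

(** * Invariance under reduction, and the specialization *)

Section Reduction.
Variable n : nat.
Implicit Types (m : xmonom n) (s : seq ({poly rat} * xmonom n)).

Definition monom_value m : tower n :=
  \prod_(e : edge n) value_at n (src e) (tgt e) ^+ m (enum_rank e).

Definition sum_value s : tower n :=
  \sum_(u <- s) base n u.1 * monom_value u.2.

Lemma monom_valueD m1 m2 :
  monom_value (m1 + m2)%MM = monom_value m1 * monom_value m2.
Proof.
by rewrite -big_split; apply: eq_bigr => e _; rewrite mnmDE exprD.
Qed.

Lemma monom_value_x (e : edge n) :
  monom_value (x e) = value_at n (src e) (tgt e).
Proof.
rewrite /monom_value (bigD1 e) //= mnm1E eqxx expr1 big1 ?mulr1 // => f nfe.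
by rewrite mnm1E (inj_eq enum_rank_inj) eq_sym (negPf nfe) expr0.
Qed.

Lemma sum_value_cat s1 s2 : sum_value (s1 ++ s2) = sum_value s1 + sum_value s2.
Proof. exact: big_cat. Qed.

Lemma sum_value_scale c s :
  sum_value [seq (c * u.1, u.2) | u <- s] = base n c * sum_value s.
Proof.
rewrite /sum_value big_map mulr_sumr; apply: eq_bigr => u _.
by rewrite rmorphM mulrA.
Qed.

Lemma sum_value_reducts m r : redex m r -> sum_value (reducts m r) = monom_value m.
Proof.
case: r => [[e f] g] rm; rewrite [in RHS](redex_split rm) /reducts.
case/and5P: rm => /eqP te /eqP sg /eqP tg _ _.
have lt_e := src_lt_tgt e; have lt_f := src_lt_tgt f.
rewrite /sum_value !big_cons big_nil /= rmorph1 !mul1r addr0.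
rewrite !monom_valueD !monom_value_x sg tg te.
rewrite te in lt_e; rewrite -[RHS]mulrA value_at_relation ?lt_e ?ltn_ord //.
by rewrite [RHS]mulrA !mulrDr -addrA [base n 'X * _]mulrC.
Qed.

Lemma reduction_sum_value s1 s2 :
  clos_refl_trans _ (@reduction n) s1 s2 -> sum_value s1 = sum_value s2.
Proof.
elim=> // [{}s1 {}s2 [u c m v r rm] | {}s1 s {}s2 _ -> _ //].
rewrite !sum_value_cat sum_value_scale (sum_value_reducts rm).
by rewrite [sum_value (_ :: _)]big_cons.
Qed.

(** Every pair i < k is an edge, so two consecutive edges always have a third one completing a
    redex. *)
Lemma irreducible_disjoint m (e f : edge n) : irreducible m ->
  (0 < m (enum_rank e))%N -> (0 < m (enum_rank f))%N -> tgt e != src f.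
Proof.
move=> /forallP irr me mf; apply/eqP=> te.
have lt_ef : (src e < tgt f)%N.
  by apply: ltn_trans (src_lt_tgt e) _; rewrite te src_lt_tgt.
have := irr (e, f, Sub (src e, tgt f) lt_ef).
by rewrite /redex /src /tgt SubK /= -/(tgt e) -/(src f) te !eqxx me mf.
Qed.

(* Vertex n - 1 is never a source; its junk value 0 is not used. *)
Definition target_var (v : nat) : {mpoly {poly rat}[n.-1]} :=
  if insub v is Some i then 'X_i else 0.

Lemma specialize_term c m :
  specialize (c *: 'X_[m]) =
  c%:MP * \prod_(e : edge n) target_var (src e) ^+ m (enum_rank e).
Proof.
rewrite /specialize comp_mpolyZ comp_mpolyX mul_mpolyC; congr (_ *: _).
rewrite (reindex enum_rank) /=; last exact: onW_bij (enum_rank_bij _).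
apply: eq_bigr => e _; rewrite tnth_mktuple enum_rankK; congr (_ ^+ _).
by rewrite /target_var insubT ?src_lt.
Qed.

Lemma specialize_irreducible c m : irreducible m ->
  specialize (c *: 'X_[m]) =
  readout (@mpolyC n.-1 _) target_var (base n c * monom_value m).
Proof.
move=> irr; rewrite specialize_term.
(* At level [n] the bounds are vacuous and the products run over all edges. *)
have all_lt (v : edge n -> 'I_n) : (fun e => v e < n)%N =1 predT.
  by move=> e; rewrite ltn_ord.
have := @readout_irreducible _ (@mpolyC n.-1 {poly rat}) target_var n n
  (fun e => m (enum_rank e)) c.
rewrite !(eq_bigl _ _ (all_lt _)) => <-; last first.
  by move=> e f; exact: irreducible_disjoint.
rewrite -mulrA -big_split; congr readout; congr (_ * _).
by apply: eq_bigr => e _; rewrite [in RHS]exprMn.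
Qed.

(** Reductions preserve [sum_value], and both [specialize] and [readout] are additive, so
    irreducible terms can be compared one by one. The right-hand side depends on [m] alone. *)
Lemma specialize_reduced_form m p : reduced_form m p ->
  specialize p = readout (@mpolyC n.-1 _) target_var (monom_value m).
Proof.
case=> s [red irr ->].
have -> : monom_value m = sum_value s.
  rewrite -(reduction_sum_value red) /sum_value big_seq1 rmorph1 mul1r //.
elim: s irr {red} => [|u s IH] /=.
  by rewrite /poly_of /sum_value !big_nil readout0 /specialize comp_mpoly0.
case/andP=> irr_u /IH{}IH; rewrite /poly_of /sum_value !big_cons readoutD.
by rewrite -specialize_irreducible // -IH /specialize comp_mpolyD.
Qed.

End Reduction.

Theorem theorem5p1 (n : nat) (T : {set edge n}) (d : direction) (R : xpoly n) :
  is_tree T -> noncrossing T -> reduced_form (tree_monom T) R ->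
  specialize R = specialize (Crf d T).
Proof.
move=> _ _ redR; rewrite (specialize_reduced_form redR).
by rewrite (specialize_reduced_form (Crf_reduced_form d T)).
Qed.
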